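(* The complete bipartite graph $K_{2,2}$ is not isomorphic to the rook equivalence graph $G(B)$ of any Ferrers board $B$.
   Context: A Ferrers board is given by a weakly increasing sequence of non-negative integers $B=(b_1,\ldots,b_n)$ of column heights; it is the set of unit cells in the first quadrant lying in column $i$ and rows $1,\ldots,b_i$. Prepending columns of height $0$ on the left does not change the board, and boards are compared using the same number of columns by such padding. A placement of $k$ rooks on $B$ is a set of $k$ cells of $B$ no two in the same row or column; $r_k(B)$ is the number of such placements. Two boards are rook equivalent if they have equal $r_k$ for all $k\ge 0$. The rook equivalence graph $G(B)$ has as vertices all Ferrers boards rook equivalent to $B$, and $\{B_1,B_2\}$ is an edge iff, written with the same number of columns, $B_1$ and $B_2$ differ in exactly two columns $i$ and $j$, where $B_1$ has $k$ more cells than $B_2$ in column $i$ and $k$ fewer cells than $B_2$ in column $j$, for some $k>0$. *)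

(* Defs.v *)
From mathcomp Require Import all_boot.
Set Implicit Arguments. Unset Strict Implicit. Unset Printing Implicit Defensive.

(* A Ferrers board is a weakly increasing sequence of column heights
   (b_1,...,b_n); column i (0-indexed) has cells in rows 1..b_i. *)
Definition ferrers (B : seq nat) : bool := sorted leq B.

(* Canonical representative of a board up to prepending zero-height columns:
   no zero columns. *)
Definition canonical_ferrers (B : seq nat) : bool :=
  ferrers B && all (fun b => 0 < b) B.

Definition max_height (B : seq nat) : nat := \max_(b <- B) b.

Definition cells (B : seq nat) : {set 'I_(size B) * 'I_(max_height B)} :=
  [set c : 'I_(size B) * 'I_(max_height B) | (c.2 : nat) < nth 0 B c.1].

Definition nonattacking (n m : nat) (P : {set 'I_n * 'I_m}) : bool :=
  [forall x in P, forall y in P, (x != y) ==> (x.1 != y.1) && (x.2 != y.2)].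

Definition rook_num (B : seq nat) (k : nat) : nat :=
  #|[set P : {set 'I_(size B) * 'I_(max_height B)} |
       [&& P \subset cells B, #|P| == k & nonattacking P]]|.

Definition rook_equiv (B1 B2 : seq nat) : Prop :=
  forall k, rook_num B1 k = rook_num B2 k.

Definition rvertex (B V : seq nat) : Prop :=
  canonical_ferrers V /\ rook_equiv V B.

Definition pad (N : nat) (s : seq nat) : seq nat := nseq (N - size s) 0 ++ s.

Definition redge (B1 B2 : seq nat) : Prop :=
  let N := maxn (size B1) (size B2) in
  let p1 := pad N B1 in let p2 := pad N B2 in
  exists i j k, [/\ i < N, j < N, i != j, 0 < k &
    [/\ nth 0 p1 i = nth 0 p2 i + k, nth 0 p1 j + k = nth 0 p2 j &
        forall l, l < N -> l != i -> l != j -> nth 0 p1 l = nth 0 p2 l]].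

Definition K22_adj (x y : bool * bool) : bool := x.1 != y.1.

Definition iso_to_rook_graph (T : finType) (adj : T -> T -> bool) (B : seq nat) : Prop :=
  exists f : T -> seq nat,
    [/\ injective f, (forall x, rvertex B (f x)),
        (forall V, rvertex B V -> exists x, f x = V) &
        (forall x y, adj x y <-> redge (f x) (f y))].

(* Main.v *)
Require Import Defs.
From mathcomp Require Import all_boot all_order all_algebra.
From mathcomp Require Import zify ring.
Set Implicit Arguments. Unset Strict Implicit. Unset Printing Implicit Defensive.
Import GRing.Theory Num.Theory.

(** Number the columns from 0 and pad with enough zero columns. Adding columns
    from left to right and the factorization
    sum_k r_k x(x-1)...(x-n+k+1) = prod_i (x + b_i - i)
    show that rook equivalence means equality of the multisets of the a_i = i - b_i.
    So the vertices of G(B) are the rearrangements w of one multiset of naturals with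
    w_0 = 0 and w_{l+1} <= w_l + 1, and adjacency means swapping two unequal entries.

    Suppose the graph is K_{2,2} and let s be the sorted word. A neighbour of s arises
    by swapping s_i = u (where also s_{i-1} = u) with an entry s_j = u+1 that is last
    or is followed by another u+1. If u+1 is less than the last entry of s, moving
    s_i to the end gives a word adjacent neither to s nor to this neighbour, which
    cannot happen in K_{2,2}. Hence both neighbours of s have the same u; if they come
    from (i1,j1) and (i2,j2), then the neighbour for (i1,j2) is equal or adjacent to
    each of them, so they coincide since K_{2,2} has no triangle. *)

(** * Words of slow growth *)

(** A column of height [b_l] is recorded as the letter [l - b_l]; the growth bound then says that
    the heights increase weakly. *)
Definition slow_word (w : seq nat) : Prop :=
  nth 0 w 0 = 0 /\ forall l, l.+1 < size w -> nth 0 w l.+1 <= (nth 0 w l).+1.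

(** The signs are opposite to those in [redge], because letters are indices minus heights. Between
    rearrangements of one multiset, such a change at two distinct positions with [k > 0] swaps two
    unequal letters. *)
Definition transfer (k i j : nat) (v w : seq nat) : Prop :=
  [/\ nth 0 v i + k = nth 0 w i, nth 0 v j = nth 0 w j + k &
      forall l, l < size v -> l != i -> l != j -> nth 0 v l = nth 0 w l].

Definition word_adj (v w : seq nat) : Prop :=
  exists i j k, [/\ i < size v, j < size v, i != j, 0 < k & transfer k i j v w].

Lemma count_nth (p : pred nat) (w : seq nat) :
  count p w = \sum_(l < size w) p (nth 0 w l).
Proof. by rewrite -sum1_count big_mkcond (big_nth 0) big_mkord. Qed.

(** Kept additive to avoid truncated subtraction. A singleton predicate identifies a swapped letter;
    arbitrary predicates yield [perm_eq]. *)
Lemma count_two_changes (p : pred nat) (v w : seq nat) (i j : nat) :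
    size v = size w -> i < size v -> j < size v -> i != j ->
    (forall l, l < size v -> l != i -> l != j -> nth 0 v l = nth 0 w l) ->
  count p v + p (nth 0 w i) + p (nth 0 w j)
    = count p w + p (nth 0 v i) + p (nth 0 v j).
Proof.
move=> szE lti ltj neij eqvw; rewrite !count_nth -szE.
rewrite (bigD1 (Ordinal lti)) //= (bigD1 (Ordinal ltj)) /=; last by rewrite -val_eqE eq_sym.
rewrite [X in _ = X + _ + _](bigD1 (Ordinal lti)) //=.
rewrite [X in _ = _ + X + _ + _](bigD1 (Ordinal ltj)) /=; last by rewrite -val_eqE eq_sym.
rewrite (eq_bigr (fun l : 'I__ => p (nth 0 w l) : nat)) => [|l /andP[nli nlj]]; last first.
  by rewrite eqvw ?ltn_ord.
lia.
Qed.

(** Discrete intermediate values: starting at 0 and rising by at most one, a word skips no value. *)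
Lemma slow_word_mem (w : seq nat) (x y : nat) :
  slow_word w -> x \in w -> y <= x -> y \in w.
Proof.
case=> w0 wS /(nthP 0)[l]; elim: l => [|l IHl] in x * => ltl <-.
  by rewrite w0 leqn0 => /eqP->; rewrite -w0 mem_nth.
rewrite leq_eqVlt => /predU1P[->|]; first exact: mem_nth.
by have := wS l ltl => ? /= ?; apply: (IHl (nth 0 w l)) => //; lia.
Qed.

Lemma sorted_nth (s : seq nat) (l m : nat) :
  sorted leq s -> l <= m -> m < size s -> nth 0 s l <= nth 0 s m.
Proof.
move=> srt lm mn; apply: (sorted_leq_nth leq_trans leqnn 0 srt) => //.
by rewrite inE (leq_ltn_trans lm).
Qed.

(** The letters fill an initial segment of the naturals, so a jump in the sorted word would leave a
    skipped value with no place to occur. *)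
Lemma slow_word_sort (w : seq nat) :
  0 < size w -> slow_word w -> slow_word (sort leq w).
Proof.
move=> w_gt0 sw; have srt := sort_sorted leq_total w.
have mem_s := mem_sort leq w.
set s := sort leq w in srt mem_s *.
have szs : size s = size w by rewrite size_sort.
split.
  have : 0 \in s by rewrite mem_s; apply: (slow_word_mem sw (mem_nth 0 w_gt0)).
  case/(nthP 0)=> m ltm sm0; have := sorted_nth srt (leq0n m) ltm.
  by rewrite sm0 leqn0 => /eqP.
move=> l ltl; rewrite leqNgt; apply/negP => gap.
have : (nth 0 s l).+1 \in s.
  rewrite mem_s; apply: (slow_word_mem sw (x := nth 0 s l.+1)); last exact: ltnW.
  by rewrite -mem_s mem_nth.
case/(nthP 0)=> m ltm sm.
case: (leqP m l) => lm.
  by have := sorted_nth srt lm (ltnW ltl); rewrite sm ltnn.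
by have := sorted_nth srt lm ltm; rewrite sm leqNgt gap.
Qed.

(** * Neighbours of the sorted word *)

Definition raise_lower (s : seq nat) (i j : nat) : seq nat :=
  mkseq (fun l => if l == i then (nth 0 s l).+1 else
                  if l == j then (nth 0 s l).-1 else nth 0 s l) (size s).

Definition delay (s : seq nat) (i : nat) : seq nat :=
  rcons (take i s ++ drop i.+1 s) (nth 0 s i).

(** Placing [u.+1] at [i] needs a previous letter at least [u]; sortedness makes it equal to [u]. *)
Definition raisable (s : seq nat) (i u : nat) : Prop :=
  [/\ 0 < i, i < size s, nth 0 s i.-1 = u & nth 0 s i = u].

(** Placing [u] at [j] needs a next letter at most [u.+1]; sortedness makes it equal to [u.+1]. *)
Definition lowerable (s : seq nat) (j u : nat) : Prop :=
  [/\ j < size s, nth 0 s j = u.+1 & j.+1 < size s -> nth 0 s j.+1 = u.+1].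

(** The letter before the raised one is unchanged and already at most [s_i], so slow growth allows a
    rise of only one. Equality of multisets then forces the lowered letter to be [s_i + 1]. *)
Lemma sorted_neighbor (s w : seq nat) :
    sorted leq s -> slow_word s -> slow_word w -> perm_eq s w -> word_adj s w ->
  exists i j u, [/\ raisable s i u, lowerable s j u & w = raise_lower s i j].
Proof.
move=> srt [s0 sS] [w0 wS] pm [i [j [k [lti ltj neij k_gt0 [wi wj wl]]]]].
have szE := perm_size pm.
have i_gt0 : 0 < i by rewrite lt0n; apply/eqP => i0; move: wi; rewrite i0 s0 w0; lia.
have lei : nth 0 s i.-1 <= nth 0 s i by apply: sorted_nth => //; lia.
have wSi : nth 0 w i <= (nth 0 w i.-1).+1.
  by have := wS i.-1; rewrite prednK // -szE; apply.
(* If the letter just before [i] were the lowered one, the ascent into [i] would be at least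
   [2 * k]. *)
have neji : i.-1 != j by apply/eqP => E; rewrite E in lei wSi; lia.
have wi1 : nth 0 s i.-1 = nth 0 w i.-1 by apply: wl => //; lia.
have k1 : k = 1 by lia.
(* Count the letters equal to [s_i + 1]: position [i] gains one, so position [j] must lose one. *)
have := count_two_changes (pred1 (nth 0 s i).+1) szE lti ltj neij wl.
rewrite /= (permP pm) -wi k1 addn1 eqxx => cE.
have sj : nth 0 s j = (nth 0 s i).+1.
  move: cE; rewrite [nth 0 s i == _]ltn_eqF //; case: (nth 0 s j =P _) => //= _.
  by move: (count _ w) => c; lia.
exists i, j, (nth 0 s i); split; first by split=> //; lia.
  split=> // ltj1; have := wS j; rewrite -szE ltj1 => /(_ isT).
  have := sorted_nth srt (leqnSn j) ltj1.
  by rewrite -wl //; lia.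
apply: (@eq_from_nth _ 0) => [|l]; rewrite -szE ?size_mkseq // => ltl.
rewrite nth_mkseq //; case: eqP => [->|/eqP nli]; first by lia.
by case: eqP => [->|/eqP nlj]; [lia | rewrite wl].
Qed.

Lemma nth_raise_lower (s : seq nat) (i j l : nat) : l < size s ->
  nth 0 (raise_lower s i j) l =
    if l == i then (nth 0 s l).+1 else
    if l == j then (nth 0 s l).-1 else nth 0 s l.
Proof. exact: nth_mkseq. Qed.

Lemma raise_lower_ne (s : seq nat) (i j u : nat) :
  raisable s i u -> lowerable s j u -> i != j.
Proof. by move=> [_ _ _ si] [_ sj _]; apply/eqP => E; move: si; rewrite E; lia. Qed.

(** Only the ascents into [i] and out of [j] can grow, and [raisable] and [lowerable] bound exactly
    these. *)
Lemma raise_lower_slow (s : seq nat) (i j u : nat) :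
    sorted leq s -> slow_word s -> raisable s i u -> lowerable s j u ->
  slow_word (raise_lower s i j).
Proof.
move=> srt [s0 sS] ri lj; have neij := raise_lower_ne ri lj.
case: ri lj => i_gt0 lti si1 si [ltj sj sj1]; split.
  by rewrite nth_raise_lower; [case: eqP; [|case: eqP]; lia | lia].
rewrite size_mkseq => l ltl; rewrite !nth_raise_lower; try lia.
have := sS l ltl; have := sorted_nth srt (leqnSn l) ltl.
case: (l.+1 =P i) => [E|_].
  rewrite -E /= in si1 si *.
  by case: (l =P j) => [El|_]; [move: sj; rewrite -El|case: eqP]; lia.
case: (l =P j) => [E|_]; last by repeat case: eqP; lia.
by rewrite E in ltl *; have := sj1 ltl; repeat case: eqP; lia.
Qed.

Lemma raise_lower_perm (s : seq nat) (i j u : nat) :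
    raisable s i u -> lowerable s j u -> perm_eq s (raise_lower s i j).
Proof.
move=> ri lj; have neij := raise_lower_ne ri lj.
case: ri lj => i_gt0 lti si1 si [ltj sj sj1].
apply/permP => p; have := @count_two_changes p s (raise_lower s i j) i j.
rewrite size_mkseq !nth_raise_lower // !eqxx (eq_sym j) (negPf neij) si sj /=.
move=> /(_ erefl lti ltj isT) cE; apply/eqP.
rewrite -(eqn_add2r (p u.+1 + p u)) !addnA; apply/eqP; rewrite cE; last first.
  by move=> l ltl /negPf nli /negPf nlj; rewrite nth_raise_lower // nli nlj.
by lia.
Qed.

Lemma raise_lower_adj (s : seq nat) (i j u : nat) :
  raisable s i u -> lowerable s j u -> word_adj s (raise_lower s i j).
Proof.
move=> ri lj; have neij := raise_lower_ne ri lj.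
case: ri lj => i_gt0 lti si1 si [ltj sj sj1].
exists i, j, 1; split=> //; split.
- by rewrite nth_raise_lower // eqxx addn1.
- by rewrite nth_raise_lower // eqxx (eq_sym j) (negPf neij) sj addn1.
by move=> l ltl /negPf nli /negPf nlj; rewrite nth_raise_lower // nli nlj.
Qed.

Lemma raise_lower_adj_lower (s : seq nat) (i j1 j2 u : nat) :
    raisable s i u -> lowerable s j1 u -> lowerable s j2 u -> j1 != j2 ->
  word_adj (raise_lower s i j1) (raise_lower s i j2).
Proof.
move=> ri lj1 lj2 ne; have ne1 := raise_lower_ne ri lj1; have ne2 := raise_lower_ne ri lj2.
case: ri lj1 lj2 => i_gt0 lti si1 si [ltj1 sj1 _] [ltj2 sj2 _].
exists j1, j2, 1; rewrite size_mkseq; split=> //; split.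
- by rewrite !nth_raise_lower // eqxx (eq_sym j1 i) (negPf ne1) (negPf ne) sj1 addn1.
- by rewrite !nth_raise_lower // eqxx (eq_sym j2 i) (negPf ne2) (eq_sym j2) (negPf ne) sj2 addn1.
rewrite size_mkseq => l ltl /negPf nl1 /negPf nl2.
by rewrite !nth_raise_lower // nl1 nl2.
Qed.

Lemma raise_lower_adj_raise (s : seq nat) (i1 i2 j u : nat) :
    raisable s i1 u -> raisable s i2 u -> lowerable s j u -> i1 != i2 ->
  word_adj (raise_lower s i1 j) (raise_lower s i2 j).
Proof.
move=> ri1 ri2 lj ne; have ne1 := raise_lower_ne ri1 lj; have ne2 := raise_lower_ne ri2 lj.
case: ri1 ri2 lj => _ lti1 _ si1 [_ lti2 _ si2] [ltj sj _].
exists i2, i1, 1; rewrite size_mkseq; split=> //; first by rewrite eq_sym.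
split.
- by rewrite !nth_raise_lower // eqxx (eq_sym i2 i1) (negPf ne) (negPf ne2) addn1.
- by rewrite !nth_raise_lower // eqxx (negPf ne) (negPf ne1) addn1.
rewrite size_mkseq => l ltl /negPf nl1 /negPf nl2.
by rewrite !nth_raise_lower // nl1 nl2.
Qed.

Lemma size_delay (s : seq nat) (i : nat) : i < size s -> size (delay s i) = size s.
Proof. by move=> lti; rewrite size_rcons size_cat size_take size_drop lti; lia. Qed.

Lemma nth_delay (s : seq nat) (i l : nat) : i < size s -> l < size s ->
  nth 0 (delay s i) l = if l == (size s).-1 then nth 0 s i else
                        if l < i then nth 0 s l else nth 0 s l.+1.
Proof.
move=> lti ltl; have := size_delay lti; rewrite size_rcons => sz.
have {}sz : size (take i s ++ drop i.+1 s) = (size s).-1 by rewrite -sz.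
rewrite nth_rcons sz; case: eqP => [->|nl]; first by rewrite ltnn.
rewrite ifT; last by lia.
rewrite nth_cat size_take lti; case: ltnP => li; first by rewrite nth_take.
by rewrite nth_drop; congr nth; lia.
Qed.

Lemma delay_perm (s : seq nat) (i : nat) : i < size s -> perm_eq s (delay s i).
Proof.
move=> lti; rewrite -{1}(cat_take_drop i s) (drop_nth 0 lti) /delay.
by rewrite -cats1 -catA perm_cat2l cats1 perm_sym perm_rcons.
Qed.

(** The removed letter leaves an equal one at [i.-1], so no gap opens, and the letter moved to the
    end is not larger than the one it follows. *)
Lemma delay_slow (s : seq nat) (i u : nat) :
    sorted leq s -> slow_word s -> raisable s i u -> slow_word (delay s i).
Proof.
move=> srt [s0 sS] [i_gt0 lti si1 si]; split.
  by rewrite nth_delay ?i_gt0 //; first case: eqP => //; lia.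
rewrite size_delay // => l ltl; rewrite !nth_delay //; last by lia.
have -> : (l == (size s).-1) = false by lia.
have := sS l ltl; case: (l.+1 =P _) => [E _|nE].
  case: ltnP => [li|il]; first by have -> : l = i.-1; lia.
  by have := sorted_nth srt (leq_trans il (leqnSn l)) ltl; lia.
case: (ltnP l.+1 i) => [li|il]; first by rewrite ifT //; lia.
case: (ltnP l i) => [li|il'] _; last by apply: sS; lia.
have El : l.+1 = i by lia.
have -> : l = i.-1 by lia.
rewrite prednK // si1 -si; apply: sS; lia.
Qed.

(** The last letter drops by at least two, while a left shift in a slow word raises any other
    position by at most one; no single transfer balances this. *)
Lemma delay_nadj_sorted (s : seq nat) (i u : nat) :
    slow_word s -> raisable s i u -> u.+1 < nth 0 s (size s).-1 ->
  ~ word_adj s (delay s i).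
Proof.
move=> [s0 sSt] [i_gt0 lti si1 si] last_s.
case=> i' [j' [k [lti' ltj' ne k_gt0 [E1 E2 E3]]]].
have ltL : (size s).-1 < size s by lia.
have dL : nth 0 (delay s i) (size s).-1 = u by rewrite nth_delay // eqxx.
have jL : (size s).-1 = j'.
  apply/eqP/negPn/negP => njL; have niL : (size s).-1 != i'.
    by apply/eqP => E; move: E1; rewrite -E dL; lia.
  by have := E3 _ ltL niL njL; rewrite dL; lia.
have : nth 0 (delay s i) i' <= (nth 0 s i').+1.
  rewrite nth_delay // ifF; last by rewrite jL; apply/negP/negP.
  by case: ifP => _; [lia | apply: sSt; lia].
by move: E2; rewrite -jL dL; lia.
Qed.

(** The last position loses at least two, so it is the losing end of any transfer. Position [j]
    rises from [u] to [u.+1], so it is the gaining end, but it gains only one. *)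
Lemma delay_nadj_neighbor (s : seq nat) (i j u : nat) :
    sorted leq s -> slow_word s -> raisable s i u -> lowerable s j u ->
    u.+1 < nth 0 s (size s).-1 ->
  ~ word_adj (raise_lower s i j) (delay s i).
Proof.
move=> srt [s0 sSt] ri lj last_s; have neij := raise_lower_ne ri lj.
case: ri lj => i_gt0 lti si1 si [ltj sj sj1].
case=> i' [j' [k [lti' ltj' ne k_gt0 [E1 E2 E3]]]].
rewrite size_mkseq in lti' ltj' E3.
have ltL : (size s).-1 < size s by lia.
have dL : nth 0 (delay s i) (size s).-1 = u by rewrite nth_delay // eqxx.
have jnL : j != (size s).-1 by apply/eqP => E; move: last_s; rewrite -E sj ltnn.
have inL : i != (size s).-1 by apply/eqP => E; move: last_s; rewrite -E si; lia.
have cL : nth 0 (raise_lower s i j) (size s).-1 = nth 0 s (size s).-1.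
  by rewrite nth_raise_lower // eq_sym (negPf inL) eq_sym (negPf jnL).
have cj : nth 0 (raise_lower s i j) j = u.
  by rewrite nth_raise_lower // eqxx (eq_sym j) (negPf neij) sj.
have ij : i < j.
  by rewrite ltnNge; apply/negP => /(sorted_nth srt) /(_ lti); lia.
have dj : nth 0 (delay s i) j = u.+1.
  by rewrite nth_delay // (negPf jnL) ifF ?sj1 //; lia.
have jL : (size s).-1 = j'.
  apply/eqP/negPn/negP => njL; have niL : (size s).-1 != i'.
    by apply/eqP => E; move: E1; rewrite -E dL cL; lia.
  by have := E3 _ ltL niL njL; rewrite dL cL; lia.
have ji : j = i'.
  apply/eqP/negPn/negP => nji; have := E3 _ ltj nji.
  by rewrite -jL dj cj => /(_ jnL); lia.
by move: E1 E2; rewrite -ji -jL dL cL dj cj; lia.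
Qed.

Lemma no_K22_words (w : seq nat) (g : bool * bool -> seq nat) :
    0 < size w -> slow_word w -> injective g ->
    (forall x, slow_word (g x) /\ perm_eq w (g x)) ->
    (forall v, slow_word v -> perm_eq w v -> exists x, g x = v) ->
    (forall x y, K22_adj x y <-> word_adj (g x) (g y)) ->
  False.
Proof.
move=> w_gt0 sw g_inj gP g_onto g_adj.
have srt := sort_sorted leq_total w; have ss := slow_word_sort w_gt0 sw.
have pws : perm_eq w (sort leq w) by rewrite perm_sym perm_sort.
have [x gx] := g_onto _ ss pws; set s := sort leq w in srt ss pws gx.
have onto v : slow_word v -> perm_eq s v -> exists y, g y = v.
  by move=> sv pv; apply: g_onto => //; apply: perm_trans pv.
have nbr b : exists i j u, [/\ raisable s i u, lowerable s j u &
    g (~~ x.1, b) = raise_lower s i j].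
  have [sy py] := gP (~~ x.1, b).
  apply: sorted_neighbor => //; first by rewrite -(permPl pws).
  by rewrite -gx; apply/g_adj; rewrite /K22_adj /=; case: (x.1).
have [i1 [j1 [u1 [r1 l1 c1]]]] := nbr true.
have [i2 [j2 [u2 [r2 l2 c2]]]] := nbr false.
(* In K_{2,2} every vertex is adjacent to one end of each edge; the delayed word would be adjacent
   to neither end of the edge from [s] to its neighbour. *)
have far b i j u : raisable s i u -> lowerable s j u ->
    g (~~ x.1, b) = raise_lower s i j -> nth 0 s (size s).-1 <= u.+1.
  move=> ri lj c; rewrite leqNgt; apply/negP => big.
  have [||y gy] := onto (delay s i).
  - exact: delay_slow srt ss ri.
  - by case: ri => _ lti _ _; apply: delay_perm.
  have [E|ne] := eqVneq x.1 y.1.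
    apply: (delay_nadj_neighbor srt ss ri lj big); rewrite -c -gy; apply/g_adj.
    by rewrite /K22_adj /= E; case: (y.1).
  by apply: (delay_nadj_sorted ss ri big); rewrite -gy -gx; apply/g_adj.
(* Together with [far], this makes [u.+1] the last letter of [s] for both neighbours. *)
have top j u : lowerable s j u -> u.+1 <= nth 0 s (size s).-1.
  by case=> ltj <- _; apply: sorted_nth => //; lia.
have uE : u1 = u2.
  have := far _ _ _ _ r1 l1 c1; have := far _ _ _ _ r2 l2 c2.
  by have := top _ _ l1; have := top _ _ l2; lia.
rewrite -{u2}uE in r2 l2.
(* The mixed exchange is adjacent to [s], hence lies on the same side as both neighbours and is
   adjacent to neither. *)
have [||y gy] := onto (raise_lower s i1 j2).
- exact: raise_lower_slow srt ss r1 l2.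
- exact: raise_lower_perm r1 l2.
have xy : K22_adj x y by apply/g_adj; rewrite gx gy; apply: raise_lower_adj r1 l2.
have jE : j1 = j2.
  apply/eqP/negPn/negP => /(raise_lower_adj_lower r1 l1 l2).
  by rewrite -c1 -gy => /g_adj; move: xy; rewrite /K22_adj /=; case: (x.1); case: (y.1).
have iE : i1 = i2.
  apply/eqP/negPn/negP => /(raise_lower_adj_raise r1 r2 l2).
  rewrite -c2 -gy => /g_adj; move: xy; rewrite /K22_adj /=; case: (x.1); case: (y.1) => //.
by have := g_inj (~~ x.1, true) (~~ x.1, false); rewrite c1 c2 iE jE => /(_ erefl).
Qed.

(** * Counting rook placements column by column *)

(** Heights form a function and [m] is independent of them, so induction on [n] changes neither the
    heights nor the row type. *)
Definition placements (n m : nat) (h : nat -> nat) (k : nat) : {set {set 'I_n * 'I_m}} :=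
  [set P : {set 'I_n * 'I_m} |
    [&& [forall c in P, (c.2 : nat) < h c.1], #|P| == k & nonattacking P]].

Lemma rook_num_placements (B : seq nat) (k : nat) :
  rook_num B k = #|placements (size B) (max_height B) (nth 0 B) k|.
Proof.
apply: eq_card => P; rewrite !inE; congr (_ && _).
by apply/subsetP/forall_inP => H c /H; rewrite inE.
Qed.

Lemma nonattackingP (n m : nat) (P : {set 'I_n * 'I_m}) :
  reflect ({in P &, injective fst} /\ {in P &, injective snd}) (nonattacking P).
Proof.
apply: (iffP forall_inP) => [H|[H1 H2] x xP].
  split=> x y xP yP E; apply/eqP/negPn/negP => ne;
    by have /forall_inP/(_ y yP) := H x xP; rewrite ne E eqxx ?andbF.
apply/forall_inP => y yP; apply/implyP => ne.
by apply/andP; split; apply: contraNneq ne; [move/H1 | move/H2] => ->.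
Qed.

Definition widen_cell (n m : nat) (c : 'I_n * 'I_m) : 'I_n.+1 * 'I_m :=
  (widen_ord (leqnSn n) c.1, c.2).

Lemma widen_cell_inj (n m : nat) : injective (@widen_cell n m).
Proof. by move=> [i r] [j s] [/ord_inj-> ->]. Qed.

Lemma widen_cell_neq (n m : nat) (c : 'I_n * 'I_m) (r : 'I_m) :
  widen_cell c != (ord_max, r).
Proof. by apply/eqP => -[E _]; have := ltn_ord c.1; rewrite E ltnn. Qed.

Lemma cell_cases (n m : nat) (c : 'I_n.+1 * 'I_m) :
  (exists c', c = widen_cell c') \/ (exists r, c = (ord_max, r)).
Proof.
case: c => i r; have [lti|] := ltnP i n.
  by left; exists (Ordinal lti, r); congr (_, _); apply: val_inj.
move=> le; right; exists r; congr (_, _); apply: val_inj => /=.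
by have := ltn_ord i; lia.
Qed.

Lemma placements_widen (n m : nat) (h : nat -> nat) (k : nat) (P : {set 'I_n * 'I_m}) :
  (@widen_cell n m @: P \in placements n.+1 m h k) = (P \in placements n m h k).
Proof.
rewrite !inE card_imset; last exact: widen_cell_inj.
congr [&& _, _ & _].
  apply/forall_inP/forall_inP => [H c cP|H _ /imsetP[c cP ->]]; last exact: H.
  by have := H (widen_cell c) (imset_f _ cP).
apply/nonattackingP/nonattackingP => -[H1 H2]; split.
- move=> c d cP dP E; apply: (@widen_cell_inj n m).
  by apply: H1; rewrite ?imset_f //= E.
- move=> c d cP dP E; apply: (@widen_cell_inj n m).
  by apply: H2; rewrite ?imset_f //= E.
- move=> _ _ /imsetP[c cP ->] /imsetP[d dP ->] [] /ord_inj E.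
  by rewrite (H1 c d).
move=> _ _ /imsetP[c cP ->] /imsetP[d dP ->] /= E.
by rewrite (H2 c d).
Qed.

Definition add_rook (n m : nat) (P : {set 'I_n * 'I_m}) (r : 'I_m) :
  {set 'I_n.+1 * 'I_m} := (ord_max, r) |: @widen_cell n m @: P.

Lemma add_rook_notin (n m : nat) (P : {set 'I_n * 'I_m}) (r : 'I_m) :
  (ord_max, r) \notin @widen_cell n m @: P.
Proof. by apply/imsetP => -[c _ /esym/eqP]; rewrite (negPf (widen_cell_neq _ _)). Qed.

(** Embedded rooks avoid the last column, so the new rook can conflict with them only through its
    row. *)
Lemma placements_add_rook (n m : nat) (h : nat -> nat) (k : nat)
    (P : {set 'I_n * 'I_m}) (r : 'I_m) :
  (add_rook P r \in placements n.+1 m h k.+1) =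
  [&& P \in placements n m h k, r < h n & r \notin snd @: P].
Proof.
have inW c : c \in P -> widen_cell c \in add_rook P r.
  by move=> cP; rewrite inE imset_f ?orbT.
have inR : (ord_max, r) \in add_rook P r by rewrite inE set11.
have inC : P \in placements n m h k -> @widen_cell n m @: P \in placements n.+1 m h k.
  by rewrite placements_widen.
apply/idP/and3P => [|[PP rh rP]].
  rewrite [_ \in _]inE cardsU1 add_rook_notin add1n eqSS.
  move=> /and3P[/forall_inP H cP /nonattackingP[H1 H2]]; split.
  - rewrite -placements_widen inE cP andTb; apply/andP; split.
      by apply/forall_inP => c cP'; apply: H; rewrite inE cP' orbT.
    apply/nonattackingP; split=> c d cP' dP'; [apply: H1|apply: H2];
      by rewrite inE ?cP' ?dP' orbT.
  - exact: (H _ inR).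
  apply/imsetP => -[c cP' E].
  have /eqP := H2 _ _ inR (inW _ cP') E.
  by rewrite eq_sym (negPf (widen_cell_neq _ _)).
have := inC PP; rewrite !inE cardsU1 add_rook_notin add1n eqSS.
move=> /and3P[/forall_inP H -> /nonattackingP[H1 H2]] /=; apply/andP; split.
  by apply/forall_inP => c /setU1P[->//|]; apply: H.
have rne c : c \in @widen_cell n m @: P -> r <> c.2.
  by case/imsetP=> d dP -> /= E; rewrite E imset_f in rP.
have mne c : c \in @widen_cell n m @: P -> ord_max <> c.1.
  case/imsetP=> d dP -> /= E; have := ltn_ord d.1.
  by rewrite -[nat_of_ord _]/(nat_of_ord (widen_ord (leqnSn n) d.1)) -E ltnn.
apply/nonattackingP; split=> c d /setU1P[->|cP] /setU1P[->|dP] //= E.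
- by case: (mne _ dP).
- by case: (mne _ cP).
- exact: H1.
- by case: (rne _ dP).
- by case: (rne _ cP).
exact: H2.
Qed.

(** Two rooks never share a column, so the last one holds at most one rook. *)
Lemma placement_cases (n m : nat) (h : nat -> nat) (k : nat) (Q : {set 'I_n.+1 * 'I_m}) :
  Q \in placements n.+1 m h k ->
  Q = @widen_cell n m @: (@widen_cell n m @^-1: Q) \/
  exists r, Q = add_rook (@widen_cell n m @^-1: Q) r.
Proof.
rewrite inE => /and3P[_ _ /nonattackingP[H1 _]].
have [/existsP[r rQ]|] := boolP [exists r, (ord_max, r) \in Q].
  right; exists r; apply/setP => c; apply/idP/idP.
    move=> cQ; case: (cell_cases c) => [[d E]|[s E]].
      by rewrite inE E imset_f ?orbT // inE -E.
    by rewrite (H1 c (ord_max, r)) ?E // ?setU11 // -E.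
  by case/setU1P => [->//|/imsetP[d]]; rewrite inE => dQ ->.
rewrite negb_exists => /forallP nQ; left; apply/setP => c; apply/idP/idP.
  move=> cQ; case: (cell_cases c) => [[d E]|[s E]].
    by rewrite E imset_f // inE -E.
  by have := nQ s; rewrite -E cQ.
by case/imsetP=> d; rewrite inE => dQ ->.
Qed.

Lemma widen_add_rookK (n m : nat) (P : {set 'I_n * 'I_m}) (r : 'I_m) :
  @widen_cell n m @^-1: add_rook P r = P.
Proof.
apply/setP => c; rewrite !inE (negPf (widen_cell_neq _ _)) /=.
by rewrite mem_imset //; apply: widen_cell_inj.
Qed.

Lemma card_rows_lt (m b : nat) : b <= m -> #|[set r : 'I_m | r < b]| = b.
Proof.
move=> bm; have widen_inj : injective (widen_ord bm) by move=> x y [] /ord_inj.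
rewrite -[RHS]card_ord -(card_imset _ widen_inj).
apply: eq_card => r; rewrite inE; apply/idP/imsetP => [rb|[x _ ->]]; last exact: (ltn_ord x).
by exists (Ordinal rb) => //; apply: val_inj.
Qed.

Lemma rows_sub (n m : nat) (h : nat -> nat) (k b : nat) (P : {set 'I_n * 'I_m}) :
    (forall i, i < n -> h i <= b) -> P \in placements n m h k ->
  snd @: P \subset [set r : 'I_m | r < b].
Proof.
move=> hb; rewrite inE => /and3P[/forall_inP H _ _].
apply/subsetP => _ /imsetP[c cP ->]; rewrite inE.
exact: leq_trans (H _ cP) (hb _ (ltn_ord _)).
Qed.

Lemma card_rows (n m : nat) (h : nat -> nat) (k : nat) (P : {set 'I_n * 'I_m}) :
  P \in placements n m h k -> #|snd @: P| = k.
Proof.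
by rewrite inE => /and3P[_ /eqP <- /nonattackingP[_ H2]]; apply: card_in_imset.
Qed.

Lemma placement_le (n m : nat) (h : nat -> nat) (k b : nat) (P : {set 'I_n * 'I_m}) :
    b <= m -> (forall i, i < n -> h i <= b) -> P \in placements n m h k ->
  k <= b.
Proof.
move=> bm hb PP; rewrite -(card_rows PP) -[leqRHS](card_rows_lt bm).
exact: subset_leq_card (rows_sub hb PP).
Qed.

Lemma card_free_rows (n m : nat) (h : nat -> nat) (k b : nat) (P : {set 'I_n * 'I_m}) :
    b <= m -> (forall i, i < n -> h i <= b) -> P \in placements n m h k ->
  #|[set r : 'I_m | (r < b) && (r \notin snd @: P)]| = b - k.
Proof.
move=> bm hb PP.
have -> : [set r : 'I_m | (r < b) && (r \notin snd @: P)]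
        = [set r : 'I_m | r < b] :\: snd @: P.
  by apply/setP => r; rewrite !inE andbC.
by rewrite cardsD (setIidPr (rows_sub hb PP)) card_rows_lt // (card_rows PP).
Qed.

(** The last column is empty or holds one rook. As it is the highest column, [k'] rooks placed
    before it block exactly [k'] of its cells. *)
Lemma card_placementsS (n m : nat) (h : nat -> nat) (k : nat) :
    h n <= m -> (forall i, i < n -> h i <= h n) ->
  #|placements n.+1 m h k| = #|placements n m h k| +
    (if k is k'.+1 then (h n - k') * #|placements n m h k'| else 0).
Proof.
move=> hm hmon; set W := [set @widen_cell n m @: (P : {set _}) | P in placements n m h k].
have cW : #|W| = #|placements n m h k|.
  by rewrite card_imset //; apply: imset_inj; apply: widen_cell_inj.
have Wsub : W \subset placements n.+1 m h k.
  by apply/subsetP => _ /imsetP[P PP ->]; rewrite placements_widen.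
rewrite -(cardsID W (placements n.+1 m h k)) (setIidPr Wsub) cW; congr (_ + _).
case: k => [|k] in W cW Wsub *.
  apply/eqP; rewrite cards_eq0 setD_eq0; apply/subsetP => Q QP.
  case: (placement_cases QP) => [E|[r E]].
    by rewrite E; apply: imset_f; rewrite -placements_widen -E.
  by move: QP; rewrite E inE cardsU1 add_rook_notin /= andbF.
transitivity (\sum_(P in placements n m h k)
    #|[set r : 'I_m | (r < h n) && (r \notin snd @: P)]|); last first.
  rewrite mulnC -sum_nat_const; apply: eq_bigr => P PP.
  exact: (card_free_rows hm hmon PP).
(* Group the placements using the last column by their remaining rooks; each fibre is parametrised
   by the free rows of that column. *)
rewrite -sum1_card (partition_big (fun Q : {set _} => @widen_cell n m @^-1: Q)
  (fun P => P \in placements n m h k)) /=; last first.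
  move=> Q /setDP[QP QW]; case: (placement_cases QP) => [E|[r E]].
    case/negP: QW; rewrite E; apply: imset_f.
    by rewrite -placements_widen -E.
  by move: QP; rewrite {1}E placements_add_rook => /and3P[].
apply: eq_bigr => P PP.
rewrite sum1_card -(card_imset _ (_ : injective (add_rook P))); last first.
  move=> r s /setP/(_ (ord_max, r)); rewrite !inE eqxx (negPf (add_rook_notin _ _)) !orbF.
  by move=> /esym/eqP[].
apply: eq_card => Q; apply/idP/imsetP => [|[r]].
  rewrite unfold_in => /andP[/setDP[QP QW] /eqP EP].
  case: (placement_cases QP) => [E|[r E]].
    case/negP: QW; rewrite E; apply: imset_f.
    by rewrite -placements_widen -E.
  rewrite EP in E; exists r => //; move: QP.
  by rewrite E placements_add_rook inE => /and3P[_ -> ->].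
rewrite inE => rP ->; rewrite unfold_in; apply/andP; split; last by rewrite widen_add_rookK.
rewrite inE placements_add_rook PP rP andbT.
rewrite andbT; apply/negP => /imsetP[P' _ /setP/(_ (ord_max, r))].
by rewrite setU11 (negPf (add_rook_notin _ _)).
Qed.

(** * Rook equivalence and shifted column heights *)

Local Open Scope ring_scope.

(* For a board with column heights b_i, listing the b_i - i from the last column to the
   first, the k-th value is the rook number r_k. *)
Fixpoint rook_poly_coef (R : comRingType) (xs : seq R) (k : nat) : R :=
  if xs is x :: s then
    rook_poly_coef s k +
    (if k is k'.+1 then (x + (size s)%:R - k'%:R) * rook_poly_coef s k' else 0)
  else (k == 0%N)%:R.

(** Unfolding twice, the coefficients of [rook_poly_coef s] are symmetric in [x] and [y]: the extra
    column in the size offsets the extra rook. *)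
Lemma rook_poly_coef_swap (R : comRingType) (x y : R) (s : seq R) :
  rook_poly_coef (x :: y :: s) =1 rook_poly_coef (y :: x :: s).
Proof.
move=> [|[|k]] /=; rewrite -?natr1; ring.
Qed.

Lemma rook_poly_coef_cons (R : comRingType) (x : R) (s t : seq R) :
  size s = size t -> rook_poly_coef s =1 rook_poly_coef t ->
  rook_poly_coef (x :: s) =1 rook_poly_coef (x :: t).
Proof. by move=> sz E [|k] /=; rewrite !E ?sz. Qed.

Lemma rook_poly_coef_mid (R : comRingType) (x : R) (s t : seq R) :
  rook_poly_coef (s ++ x :: t) =1 rook_poly_coef (x :: s ++ t).
Proof.
elim: s => [|y s IHs] k //; rewrite rook_poly_coef_swap.
by apply: rook_poly_coef_cons IHs k; rewrite /= !size_cat /= addnS.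
Qed.

Lemma rook_poly_coef_perm (R : comRingType) (s t : seq R) :
  perm_eq s t -> rook_poly_coef s =1 rook_poly_coef t.
Proof.
elim: s t => [|x s IHs] t st; first by move: st; rewrite perm_sym => /perm_nilP->.
have xt : x \in t by rewrite -(perm_mem st) mem_head.
case/splitPr: xt st => t1 t2; rewrite perm_sym perm_catC /= perm_cons perm_catC perm_sym => st k.
rewrite rook_poly_coef_mid; apply: rook_poly_coef_cons (IHs _ st) k.
exact: perm_size.
Qed.

Definition ffact_poly (R : comRingType) (n : nat) : {poly R} :=
  \prod_(i < n) ('X - i%:R%:P).

Lemma rook_poly_coef_gt (R : comRingType) (s : seq R) (k : nat) :
  (size s < k)%N -> rook_poly_coef s k = 0.
Proof.
elim: s k => [|x s IHs] [|k] //= sk; rewrite !IHs ?mulr0 ?addr0 //; lia.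
Qed.

(** Write [n] for the size of [s]. Splitting [X + x] as [(X - (n - k)) + (x + n - k)] against the
    falling factorial of degree [n - k] reproduces the two terms of the recursion. *)
Lemma rook_factorization (R : comRingType) (s : seq R) :
  \prod_(x <- s) ('X + x%:P) =
  \sum_(k < (size s).+1) (rook_poly_coef s k) *: ffact_poly R (size s - k).
Proof.
elim: s => [|x s IHs].
  by rewrite big_nil big_ord1 /= scale1r /ffact_poly big_ord0.
rewrite big_cons IHs [RHS]big_ord_recl /=.
under [in RHS]eq_bigr => i _ do rewrite /bump /= add1n subSS scalerDl.
rewrite big_split /= addr0 addrA.
(* Both sides are the same sum; the additional term on the left has coefficient zero, there being
   more rooks than columns. *)
have -> : rook_poly_coef s 0 *: ffact_poly R ((size s).+1 - 0) +
   \sum_(i < (size s).+1) rook_poly_coef s i.+1 *: ffact_poly R (size s - i) =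
   \sum_(i < (size s).+1) rook_poly_coef s i *: ffact_poly R ((size s).+1 - i).
  rewrite [RHS]big_ord_recl; congr (_ + _).
  by rewrite big_ord_recr /= rook_poly_coef_gt // scale0r addr0.
rewrite -big_split /= mulr_sumr; apply: eq_bigr => k _.
have lk : (k <= size s)%N by rewrite -ltnS.
rewrite subSn // /ffact_poly big_ord_recr /= -/(ffact_poly _ _).
rewrite -!mul_polyC natrB // !(polyCM, polyCD, polyCN, polyCB) /=; ring.
Qed.

(** The factorization turns equal coefficients into equal products, and over a field the linear
    factors of a product are unique. *)
Lemma perm_eq_rook_poly_coef (F : fieldType) (s t : seq F) :
  size s = size t -> rook_poly_coef s =1 rook_poly_coef t -> perm_eq s t.
Proof.
move=> sz E; have : \prod_(x <- s) ('X + x%:P) = \prod_(x <- t) ('X + x%:P).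
  by rewrite !rook_factorization sz; apply: eq_bigr => k _; rewrite E.
have conv (u : seq F) : \prod_(x <- u) ('X + x%:P) = \prod_(x <- map -%R u) ('X - x%:P).
  by rewrite big_map; apply: eq_bigr => x _; rewrite polyCN opprK.
rewrite !conv => /prod_XsubC_eq; exact/perm_map_inj/oppr_inj.
Qed.

Local Close Scope ring_scope.

(** The zero column stands first while [card_placementsS] strips the last one, so the induction
    peels from the right until only the zero column remains. *)
Lemma card_placements_shift (n m : nat) (h : nat -> nat) (k : nat) :
    h 0 = 0 -> (forall i, i < n.+1 -> h i <= m) ->
    (forall i j, i <= j -> j < n.+1 -> h i <= h j) ->
  #|placements n.+1 m h k| = #|placements n m (h \o succn) k|.
Proof.
move=> h0; elim: n k => [|n IHn] k hm hmon.
  rewrite card_placementsS ?h0 //.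
  have -> : #|placements 0 m h k| = #|placements 0 m (h \o succn) k|.
    apply: eq_card => P; rewrite !inE; congr (_ && _).
    by apply/forall_inP/forall_inP => _ [[]].
  by case: k => [|k]; rewrite addn0.
rewrite card_placementsS; [|exact: hm|by move=> i lti; apply: hmon; lia].
rewrite [RHS]card_placementsS /=; [|exact: hm|by move=> i lti; apply: hmon; lia].
have {}IHn k' : #|placements n.+1 m h k'| = #|placements n m (h \o succn) k'|.
  by apply: IHn => [i ?|i j ? ?]; [apply: hm|apply: hmon] => //; lia.
by rewrite IHn; case: k => [//|k]; rewrite IHn.
Qed.

Lemma sorted_nseq_cat (d : nat) (V : seq nat) :
  sorted leq V -> sorted leq (nseq d 0 ++ V).
Proof.
elim: d => [//|d IHd] /IHd srt.
by rewrite /= (path_sortedE leq_trans) srt andbT; apply/allP.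
Qed.

Lemma rook_num_pad (N : nat) (V : seq nat) (k : nat) :
    ferrers V -> size V <= N ->
  rook_num V k = #|placements N (max_height V) (nth 0 (pad N V)) k|.
Proof.
move=> srt VN; rewrite rook_num_placements /pad; set m := max_height V.
rewrite -[in RHS](subnK VN) addnK; elim: (N - size V) => [//|d ->].
have srt0 := sorted_nseq_cat d.+1 srt.
have le_m x : x \in nseq d.+1 0 ++ V -> x <= m.
  rewrite mem_cat mem_nseq => /orP[/eqP-> //|xV].
  by rewrite /m /max_height (big_rem x) //= leq_maxl.
rewrite addSn card_placements_shift //=.
- move=> i lti; apply: le_m; apply: (mem_nth 0 (s := nseq d.+1 0 ++ V)).
  by rewrite size_cat size_nseq.
move=> i j ij ltj; apply: (sorted_nth srt0 ij).
by rewrite size_cat size_nseq.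
Qed.

Local Open Scope ring_scope.

(** Entries may be negative, and uniqueness of factors is used over a field; hence rationals. *)
Definition excess (n : nat) (h : nat -> nat) : seq rat :=
  mkseq (fun i => (h i)%:R - i%:R) n.

(** The list is reversed because [rook_poly_coef] treats its head as the last column. *)
Lemma card_placements_coef (n m : nat) (h : nat -> nat) (k : nat) :
    (forall i, (i < n)%N -> (h i <= m)%N) ->
    (forall i j, (i <= j)%N -> (j < n)%N -> (h i <= h j)%N) ->
  (#|placements n m h k|)%:R = rook_poly_coef (rev (excess n h)) k.
Proof.
elim: n k => [|n IHn] k hm hmon.
  congr (_%:R); have [->|k0] := eqVneq k 0%N.
    rewrite (_ : placements 0 m h 0 = [set set0]) ?cards1 //.
    apply/setP => P; rewrite !inE; have -> : P = set0 by apply/setP => -[[]].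
    rewrite eqxx cards0 /=; apply/andP; split; first by apply/forall_inP => -[[]].
    by apply/forall_inP => -[[]].
  apply/eqP; rewrite cards_eq0; apply/eqP/setP => P; rewrite !inE.
  have -> : P = set0 by apply/setP => -[[]].
  by rewrite cards0 eq_sym (negPf k0) andbF.
have {}IHn k' : (#|placements n m h k'|)%:R = rook_poly_coef (rev (excess n h)) k'.
  by apply: IHn => [i ?|i j ? ?]; [apply: hm|apply: hmon] => //; lia.
have hn : forall i, (i < n)%N -> (h i <= h n)%N by move=> i ?; apply: hmon; lia.
rewrite card_placementsS ?hm // /excess mkseqS rev_rcons /= -/(excess n h) natrD IHn.
case: k => [//|k]; congr (_ + _).
rewrite natrM -IHn size_rev size_mkseq subrK.
(* Natural subtraction truncates only when [k] exceeds the greatest height, and then no placement of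
   [k] rooks exists. *)
have [kh|hk] := leqP k (h n); first by rewrite natrB.
suff -> : #|placements n m h k| = 0%N by rewrite !mulr0.
apply/eqP; rewrite cards_eq0; apply/eqP/setP => P; rewrite [RHS]inE.
by apply/negP => /(placement_le (hm _ (ltnSn n)) hn); lia.
Qed.

(** Unique factorization gives one direction, symmetry of the coefficients in the list entries the
    other. *)
Lemma rook_equiv_perm (N : nat) (V W : seq nat) :
    ferrers V -> ferrers W -> (size V <= N)%N -> (size W <= N)%N ->
  rook_equiv V W <-> perm_eq (excess N (nth 0 (pad N V))) (excess N (nth 0 (pad N W))).
Proof.
move=> srtV srtW VN WN.
have coef U k : ferrers U -> (size U <= N)%N ->
    (rook_num U k)%:R = rook_poly_coef (rev (excess N (nth 0 (pad N U)))) k.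
  move=> srtU UN; have szU : size (pad N U) = N by rewrite size_cat size_nseq subnK.
  rewrite (rook_num_pad k srtU UN) card_placements_coef //.
    move=> i lti; have : nth 0 (pad N U) i \in pad N U by rewrite mem_nth ?szU.
    rewrite mem_cat mem_nseq => /orP[/andP[_ /eqP->] //|xU].
    by rewrite /max_height (big_rem _ xU) /= leq_maxl.
  by move=> i j ij ltj; apply: sorted_nth; rewrite ?szU // sorted_nseq_cat.
split=> [E|pm k].
  rewrite -perm_rev perm_sym -perm_rev perm_sym; apply: perm_eq_rook_poly_coef.
    by rewrite !size_rev !size_mkseq.
  by move=> k; rewrite -!coef // E.
apply/eqP; rewrite -(eqr_nat rat) !coef //; apply/eqP/rook_poly_coef_perm.
by rewrite perm_rev perm_sym perm_rev perm_sym.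
Qed.

Local Close Scope ring_scope.

(** * Boards as words *)

(** The subtraction is faithful only for boards satisfying [below_diagonal]. *)
Definition board_word (N : nat) (V : seq nat) : seq nat :=
  mkseq (fun i => i - nth 0 (pad N V) i) N.

Definition below_diagonal (N : nat) (V : seq nat) : Prop :=
  forall i, i < N -> nth 0 (pad N V) i <= i.

Lemma size_pad (N : nat) (V : seq nat) : size V <= N -> size (pad N V) = N.
Proof. by move=> VN; rewrite size_cat size_nseq subnK. Qed.

Lemma nth_pad (N : nat) (V : seq nat) (i : nat) :
  nth 0 (pad N V) i = if i < N - size V then 0 else nth 0 V (i - (N - size V)).
Proof. by rewrite nth_cat size_nseq; case: ifP => // ilt; rewrite nth_nseq ilt. Qed.

Lemma pad_filter (p : seq nat) :
  sorted leq p -> pad (size p) [seq x <- p | 0 < x] = p.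
Proof.
elim: p => [//|[|x] t IHt] srt.
  rewrite /pad /= subSn; last by rewrite size_filter count_size.
  by rewrite /= -/(pad _ _) IHt //; apply: path_sorted srt.
rewrite (all_filterP _) /pad ?subnn //=; apply/allP => y yt.
by apply: leq_trans (allP (order_path_min leq_trans srt) y yt).
Qed.

Lemma filter_pad (N : nat) (V : seq nat) :
  canonical_ferrers V -> [seq x <- pad N V | 0 < x] = V.
Proof.
case/andP=> _ posV; rewrite filter_cat (all_filterP posV) (eq_in_filter (a2 := pred0)) ?filter_pred0 //.
by move=> x; rewrite mem_nseq => /andP[_ /eqP->].
Qed.

Lemma excess_board_word (N : nat) (V : seq nat) :
  below_diagonal N V ->
  excess N (nth 0 (pad N V)) = [seq (- a%:R)%R : rat | a <- board_word N V].
Proof.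
move=> bd; rewrite -map_comp; apply/eq_in_map => i; rewrite mem_iota add0n => lti.
by rewrite /= natrB ?opprB //; apply: bd.
Qed.

Lemma below_diagonal_board (N : nat) (B : seq nat) :
  size B + max_height B <= N -> below_diagonal N B.
Proof.
move=> BN i lti; rewrite nth_pad; case: ltnP => // le.
apply: leq_trans (_ : max_height B <= _); last by lia.
have ltB : i - (N - size B) < size B by lia.
by rewrite /max_height (big_rem _ (mem_nth 0 ltB)) leq_maxl.
Qed.

(** Being below the diagonal means having no positive entry in [excess], a property of the multiset
    alone. *)
Lemma rook_equiv_below_diagonal (N : nat) (V B : seq nat) :
    ferrers V -> ferrers B -> size V <= N -> size B <= N ->
    rook_equiv V B -> below_diagonal N B -> below_diagonal N V.
Proof.
move=> srtV srtB VN BN /(rook_equiv_perm srtV srtB VN BN) pm bdB i lti.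
have : ((nth 0 (pad N V) i)%:R - i%:R)%R \in excess N (nth 0 (pad N B)).
  by rewrite -(perm_mem pm); apply: map_f; rewrite mem_iota.
rewrite excess_board_word // => /mapP[a _ E].
by rewrite -(ler_nat rat) -subr_le0 E oppr_le0 ler0n.
Qed.

(** A single [N] serves all vertices. If [V] had more than [N] columns, padding [B] to the size of
    [V] would force height 0 on the first column of [V], which is positive. *)
Lemma rvertex_bounded (N : nat) (V B : seq nat) :
    ferrers B -> size B + max_height B <= N -> rvertex B V ->
  size V <= N /\ below_diagonal N V.
Proof.
move=> srtB BN [/andP[srtV posV] eqVB].
have bd N' : N <= N' -> size V <= N' -> below_diagonal N' V.
  move=> NN' VN'; apply: rook_equiv_below_diagonal eqVB _ => //; first by lia.
  by apply: below_diagonal_board; lia.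
have VN : size V <= N.
  rewrite leqNgt; apply/negP => NV.
  have V0 : 0 < size V by lia.
  have := bd _ (ltnW NV) (leqnn _) 0 V0; rewrite nth_pad subnn /= leqn0.
  by have := allP posV _ (mem_nth 0 V0); rewrite lt0n => /negPf->.
by split=> //; apply: bd.
Qed.

Lemma board_word_slow (N : nat) (V : seq nat) :
  0 < N -> ferrers V -> size V <= N -> slow_word (board_word N V).
Proof.
move=> N_gt0 srt VN; split; first by rewrite nth_mkseq.
rewrite size_mkseq => l ltl; rewrite !nth_mkseq //; last by lia.
have : nth 0 (pad N V) l <= nth 0 (pad N V) l.+1.
  by apply: sorted_nth; rewrite ?size_pad // sorted_nseq_cat.
lia.
Qed.

Lemma board_word_inj (N : nat) (V W : seq nat) :
    canonical_ferrers V -> canonical_ferrers W -> size V <= N -> size W <= N ->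
    below_diagonal N V -> below_diagonal N W ->
  board_word N V = board_word N W -> V = W.
Proof.
move=> cV cW VN WN bV bW E; rewrite -(filter_pad N cV) -(filter_pad N cW).
congr filter; apply: (@eq_from_nth _ 0); rewrite !size_pad // => i lti.
have := congr1 (fun s => nth 0 s i) E; rewrite !nth_mkseq //.
by have := bV i lti; have := bW i lti; lia.
Qed.

(** Take the heights [i - w_i], weakly increasing by slow growth, and drop the zero columns to reach
    the canonical board. *)
Lemma board_word_onto (N : nat) (w : seq nat) :
    size w = N -> slow_word w ->
  exists V, [/\ canonical_ferrers V, size V <= N, below_diagonal N V & board_word N V = w].
Proof.
move=> szw [w0 wS].
have w_le i : i < N -> nth 0 w i <= i.
  elim: i => [|i IHi] lti; first by rewrite w0.
  by have := wS i; rewrite szw lti => /(_ isT); have := IHi (ltnW lti); lia.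
pose p := mkseq (fun i => i - nth 0 w i) N; pose V := [seq x <- p | 0 < x].
have srt : sorted leq p.
  apply/(sortedP 0) => i; rewrite size_mkseq => lti; rewrite !nth_mkseq //; last by lia.
  by have := wS i; rewrite szw lti => /(_ isT); lia.
have padV : pad N V = p by have := pad_filter srt; rewrite size_mkseq.
exists V; split.
- by rewrite /canonical_ferrers /ferrers sorted_filter ?filter_all //; apply: leq_trans.
- by rewrite size_filter (leq_trans (count_size _ _)) // size_mkseq.
- by move=> i lti; rewrite padV nth_mkseq //; lia.
apply: (@eq_from_nth _ 0); rewrite size_mkseq // => i lti.
by rewrite nth_mkseq // padV nth_mkseq // subKn // w_le.
Qed.

(** [redge] pads only to the longer board, so its column indices are those of the words shifted by
    [N - M]. *)
Lemma redge_word_adj (N : nat) (V W : seq nat) :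
    size V <= N -> size W <= N -> below_diagonal N V -> below_diagonal N W ->
  redge V W <-> word_adj (board_word N V) (board_word N W).
Proof.
move=> VN WN bV bW; rewrite /redge /word_adj size_mkseq.
set M := maxn _ _; have MN : M <= N by rewrite geq_max VN.
have padE U l : size U <= M -> l < M -> nth 0 (pad N U) (l + (N - M)) = nth 0 (pad M U) l.
  by move=> UM lM; rewrite !nth_pad; do 2! case: ltnP => ?; try lia; congr nth; lia.
have pad0 U l : size U <= M -> l < N - M -> nth 0 (pad N U) l = 0.
  by move=> UM lM; rewrite nth_pad ifT //; lia.
have VM : size V <= M by apply: leq_maxl.
have WM : size W <= M by apply: leq_maxr.
split=> [] [i [j [k [lti ltj ne k_gt0 [E1 E2 E3]]]]].
  exists (i + (N - M)), (j + (N - M)), k.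
  have [ltiN ltjN] : i + (N - M) < N /\ j + (N - M) < N by lia.
  split=> //; first by rewrite eqn_add2r.
  split.
  - have := bV _ ltiN; have := bW _ ltiN; rewrite !nth_mkseq // !padE //; lia.
  - have := bV _ ltjN; have := bW _ ltjN; rewrite !nth_mkseq // !padE //; lia.
  rewrite size_mkseq => l ltl nli nlj; rewrite !nth_mkseq //; congr (_ - _).
  case: (ltnP l (N - M)) => lM; first by rewrite !pad0.
  by rewrite -(subnK lM) !padE ?E3 //; lia.
rewrite size_mkseq in E3; rewrite !nth_mkseq // in E1 E2.
have bVi := bV _ lti; have bWi := bW _ lti; have bVj := bV _ ltj; have bWj := bW _ ltj.
(* The first [N - M] columns are zero in both boards, so neither changed position lies there. *)
have Mi : N - M <= i by rewrite leqNgt; apply/negP => iM; rewrite !pad0 // in E1; lia.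
have Mj : N - M <= j by rewrite leqNgt; apply/negP => jM; rewrite !pad0 // in E2; lia.
exists (i - (N - M)), (j - (N - M)), k.
rewrite -!padE ?subnK //; try lia.
split; try lia; split; try lia.
move=> l lM nli nlj; rewrite -!padE //.
have ltl : l + (N - M) < N by lia.
have := E3 _ ltl; rewrite !nth_mkseq // => /(_ _ _)E.
have {}E : l + (N - M) - nth 0 (pad N V) (l + (N - M)) =
  l + (N - M) - nth 0 (pad N W) (l + (N - M)) by apply: E; lia.
by have := bV _ ltl; have := bW _ ltl; lia.
Qed.

Theorem theorem12 (B : seq nat) :
  ferrers B -> ~ iso_to_rook_graph K22_adj B.
Proof.
move=> srtB [f [f_inj fP f_onto f_adj]].
(* The successor keeps the words nonempty even for the empty board. *)
pose N := (size B + max_height B).+1.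
have BN : size B <= N by rewrite /N; lia.
have bB : below_diagonal N B by apply: below_diagonal_board; rewrite /N.
have equivE V : ferrers V -> size V <= N -> below_diagonal N V ->
    rook_equiv V B <-> perm_eq (board_word N V) (board_word N B).
  move=> srtV VN bV; rewrite (rook_equiv_perm srtV srtB VN BN) !excess_board_word //.
  split=> [|pm]; last exact: perm_map.
  by apply: perm_map_inj => a b /oppr_inj /eqP; rewrite eqr_nat => /eqP.
have fb x : size (f x) <= N /\ below_diagonal N (f x).
  by apply: rvertex_bounded (fP x); rewrite // /N.
apply: (@no_K22_words (board_word N B) (board_word N \o f)).
- by rewrite size_mkseq.
- exact: board_word_slow.
- move=> x y /= E; apply: f_inj.
  have [[cx _] [cy _]] := (fP x, fP y); have [[sx bx] [sy by_]] := (fb x, fb y).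
  exact: (board_word_inj cx cy sx sy bx by_ E).
- move=> x; have [sx bx] := fb x; have [/andP[srtx _] ex] := fP x; split.
    exact: board_word_slow.
  by rewrite perm_sym; apply/equivE.
- move=> v sv pv; have := perm_size pv; rewrite size_mkseq => /esym szv.
  have [V [cV VN bV Vv]] := board_word_onto szv sv.
  have [|x fx] := f_onto V; last by exists x; rewrite /= fx.
  split=> //; apply/equivE => //; first by case/andP: cV.
  by rewrite Vv perm_sym.
move=> x y; have [[sx bx] [sy by_]] := (fb x, fb y).
by rewrite f_adj; apply: redge_word_adj.
Qed.
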